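(* Let $p\in[1,+\infty]$ with conjugate exponent $q$, let $(\Omega,\mathcal A,\mathbb P)$ be a probability space, and let $R\subset\mathcal P_q(\mathbb R)$ be a nonempty set which is bounded, i.e. $\sup_{r\in R}\mathcal M_q(r)<+\infty$, and such that every $r\in R$ satisfies $\mathrm{supp}(r)\subset\mathbb R_+$ and $\int_{\mathbb R}y\,\mathrm dr(y)=1$. Then the mapping $\rho_R:\mathbb L^p(\Omega,\mathbb R)\to\mathbb R$, $\rho_R(X)=\chi_R(\mathbb P_X)$, is a law-invariant coherent risk measure.
   Context: The conjugate exponent $q$ of $p$ satisfies $1/p+1/q=1$ ($q=+\infty$ if $p=1$, $q=1$ if $p=+\infty$), and $\mathbb R_+=[0,+\infty)$. For a Borel probability measure $m$ on $\mathbb R$, $\mathcal M_s(m)=\big(\int|x|^s\,\mathrm dm(x)\big)^{1/s}$ if $s<+\infty$ and $\mathcal M_\infty(m)=\sup_{x\in\mathrm{supp}(m)}|x|$; $\mathcal P_s(\mathbb R)$ is the set of Borel probability measures on $\mathbb R$ with $\mathcal M_s(m)<+\infty$ (so $\mathcal P_\infty(\mathbb R)$ is the set of compactly supported ones). $\mathbb P_X$ denotes the law of a random variable $X$. For $m\in\mathcal P_p(\mathbb R)$, $\Pi(m,R)$ is the set of Borel probability measures $\pi$ on $\mathbb R^2$ whose first marginal is $m$ and whose second marginal belongs to $R$, and $\chi_R(m)=\sup_{\pi\in\Pi(m,R)}\int_{\mathbb R^2}xy\,\mathrm d\pi(x,y)$. A risk measure is a real-valued map $\rho:\mathbb L^p(\Omega,\mathbb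 R)\to\mathbb R$. It is coherent if for all $X_1,X_2,X\in\mathbb L^p(\Omega,\mathbb R)$, $\alpha\in\mathbb R$, $\delta\ge0$, $\theta\in[0,1]$: (i) $\rho(X+\alpha)=\rho(X)+\alpha$; (ii) $\rho(\delta X)=\delta\rho(X)$; (iii) $\rho(X_1)\le\rho(X_2)$ whenever $X_1\le X_2$ almost surely; (iv) $\rho((1-\theta)X_1+\theta X_2)\le(1-\theta)\rho(X_1)+\theta\rho(X_2)$. It is law-invariant if $\rho(X_1)=\rho(X_2)$ whenever $\mathbb P_{X_1}=\mathbb P_{X_2}$. *)

(* Defs.v *)
From HB Require Import structures.
From mathcomp Require Import all_boot all_order all_algebra.
From mathcomp Require Import all_classical all_reals all_analysis.
From mathcomp Require Import ess_sup_inf.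

Set Implicit Arguments.
Unset Strict Implicit.
Unset Printing Implicit Defensive.

Import Order.TTheory GRing.Theory Num.Theory.
Import numFieldNormedType.Exports.

Local Open Scope classical_set_scope.
Local Open Scope ring_scope.
Local Open Scope ereal_scope.

Section measures_on_the_line.
Context {R : realType}.
Implicit Types (m : probability R R) (s : \bar R) (S : set (probability R R)).

Definition msupport m : set R :=
  [set x | forall U : set R, open U -> U x -> 0 < m U].

(* The value at -oo is irrelevant: only s >= 1 is meaningful. For s = +oo the
   library's Lnorm would be an essential supremum, not a supremum over the
   support, hence the separate clause. *)
Definition moment s m : \bar R :=
  match s with
  | s'%:E => 'N[m]_(s'%:E)[EFin]
  | +oo => ereal_sup [set `|x|%:E | x in msupport m]
  | -oo => 0
  end.

Definition finite_moment s : set (probability R R) :=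
  [set m | moment s m < +oo].

(* A measure is a function on all subsets that is only meaningful on the
   measurable ones, so equality of laws is equality on measurable sets, not
   Leibniz equality. *)
Definition couplings m S : set (probability (R * R)%type R) :=
  [set pi | (forall A, measurable A -> pi (fst @^-1` A) = m A) /\
    exists2 r, S r & forall A, measurable A -> pi (snd @^-1` A) = r A].

Definition chi S m : \bar R :=
  ereal_sup [set \int[pi]_z (z.1 * z.2)%:E | pi in couplings m S].

End measures_on_the_line.

Section risk_measures.
Context d (T : measurableType d) (R : realType) (P : probability T R).
Context (p : \bar R) (p1 : 1 <= p).
Implicit Types rho : LfunType P p1 -> R.

Definition law (X : LfunType P p1) : probability R R := distribution P X.

Lemma cst_Lfun (c : R) : (cst c : T -> R) \in Lfun P p.
Proof.
case: p p1 => [r _|_|//]; first exact: Lfun_cst.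
rewrite inE; apply/andP; split; first by rewrite inE; exact: measurable_cst.
have PT : 0 < (P : {measure set T -> \bar R}) [set: T].
  by rewrite [X in 0 < X](_ : _ = 1)//; exact: probability_setT.
rewrite inE /= /finite_norm unlock /Lnorm PT.
by rewrite (_ : _ \o _ = cst `|c|%:E)// ess_sup_cst ?ltry.
Qed.

Definition Lcst (c : R) : LfunType P p1 := Lfun_Sub p1 (cst_Lfun c).

(* Elements of LfunType are functions rather than classes modulo almost sure
   equality; a map on L^p is a map on LfunType that respects this relation. *)
Definition risk_measure rho : Prop :=
  forall X1 X2 : LfunType P p1,
    (\forall w \ae P, X1 w = X2 w) -> rho X1 = rho X2.

Definition coherent rho : Prop :=
  [/\ forall (X : LfunType P p1) (a : R), rho (X + Lcst a)%R = (rho X + a)%R,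
      forall (X : LfunType P p1) (c : R), (0 <= c)%R ->
        rho (c *: X)%R = (c * rho X)%R,
      forall X1 X2 : LfunType P p1,
        (\forall w \ae P, (X1 w <= X2 w)%R) -> (rho X1 <= rho X2)%R
    & forall (X1 X2 : LfunType P p1) (t : R), (0 <= t <= 1)%R ->
        (rho ((1 - t) *: X1 + t *: X2) <= (1 - t) * rho X1 + t * rho X2)%R].

Definition law_invariant rho : Prop :=
  forall X1 X2 : LfunType P p1,
    (forall A, measurable A -> law X1 A = law X2 A) -> rho X1 = rho X2.

(* fine sends infinite values to 0, so this is the intended map only where
   chi S (law X) is finite. *)
Definition rho_of (S : set (probability R R)) : LfunType P p1 -> R :=
  fun X => fine (chi S (law X)).

End risk_measures.

(* Main.v *)
Require Import Defs.
From HB Require Import structures.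
From mathcomp Require Import all_boot all_order all_algebra.
From mathcomp Require Import all_classical all_reals all_analysis.
From mathcomp Require Import ess_sup_inf measurable_realfun ring lra.

Set Implicit Arguments.
Unset Strict Implicit.
Unset Printing Implicit Defensive.

Import Order.TTheory GRing.Theory Num.Theory.
Import numFieldNormedType.Exports.

Local Open Scope classical_set_scope.
Local Open Scope ring_scope.
Local Open Scope ereal_scope.

(** The heart of the matter is a dual representation of chi: for X in L^p, it
    is the supremum of the linear functionals X |-> E_Q[X y], where Q ranges
    over the probabilities on T * (R * R) whose marginal on T is P and under
    which the last coordinate y has its law in S (a scenario). Since y >= 0
    almost surely and E_Q[y] = 1, each of these functionals is linear, monotone
    and fixes the constants, and the four axioms of coherence pass to the
    supremum (rho_coherent). That chi depends on the law of X only is built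
    into its definition.

    One inequality of the representation is plain (scenario_le_rho): under a
    scenario, the pair (X, y) is distributed according to a coupling of the law
    of X with an element of S. For the other one, a coupling pi of the law of X
    with r in S has to be lifted to T: the point w of T must be drawn together
    with (x, y) so that X w = x and (x, y) has law pi. An exact lift
    disintegrates pi with respect to its first marginal; an approximate lift is
    elementary and suffices (rho_le_scenario).
    Cut the line into countably many cells of length e and draw w and (x, y)
    independently under P and pi, conditionally on X w and x falling into the
    same cell. Both marginals are exactly P and pi, because X w and x fall into
    each cell with the same probability; the joint law has an explicit density
    with respect to P \x pi (lemma gluing). As |X w - x| < e and y is
    nonnegative with mean 1, replacing x by X w in the mean of x y costs at most
    e.

    Finiteness of chi is the Hoelder inequality, for conjugate exponents in
    [1, +oo]; the exponent +oo requires that a probability on the line be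
    carried by its support (ae_msupport), so that the supremum of |x| over the
    support is the essential supremum (momentE). *)


(** * Images of measures *)

(** Asked on measurable sets only: a measure takes meaningless values on the
    other sets, so an equality with a pushforward would be too strong. *)
Definition has_law d d' (U : measurableType d) (V : measurableType d')
    (R : realType) (mu : set U -> \bar R) (h : U -> V) (nu : set V -> \bar R) :=
  forall A, measurable A -> mu (h @^-1` A) = nu A.

Section image_law.
Context d d' (U : measurableType d) (V : measurableType d') (R : realType).
Variables (mu : {measure set U -> \bar R}) (nu : {measure set V -> \bar R}).
Variable h : U -> V.
Hypotheses (mh : measurable_fun [set: U] h) (hnu : has_law mu h nu).

Lemma ge0_integral_law (f : V -> \bar R) :
  measurable_fun [set: V] f -> (forall y, 0 <= f y) ->
  \int[nu]_y f y = \int[mu]_x f (h x).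
Proof.
move=> mf f0; rewrite -(@eq_measure_integral _ _ _ _ _ (pushforward mu h)).
  by rewrite ge0_integral_pushforward.
by move=> A mA _; exact: hnu.
Qed.

Lemma integral_law (f : V -> \bar R) :
  measurable_fun [set: V] f -> mu.-integrable [set: U] (f \o h) ->
  \int[nu]_y f y = \int[mu]_x f (h x).
Proof.
move=> mf intf; rewrite -(@eq_measure_integral _ _ _ _ _ (pushforward mu h)).
  by rewrite integral_pushforward.
by move=> A mA _; exact: hnu.
Qed.

Lemma ae_law (Q : V -> Prop) :
  (\forall y \ae nu, Q y) -> \forall x \ae mu, Q (h x).
Proof.
move=> [N [mN N0 QN]]; exists (h @^-1` N); split.
- by rewrite -[X in measurable X]setTI; exact: mh.
- by rewrite hnu.
- by move=> x /= nQ; exact: QN.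
Qed.

Lemma Lnorm_law (p : \bar R) (f : V -> \bar R) : 0 <= p ->
  measurable_fun [set: V] f -> 'N[nu]_p[f] = 'N[mu]_p[f \o h].
Proof.
move=> p0 mf; have nuT : nu setT = mu setT by rewrite -hnu.
rewrite unlock; case: p p0 => [r _|_|//].
  rewrite ge0_integral_law//.
  - apply: (@measurableT_comp _ _ _ _ _ _ (@poweR R ^~ r)) => //.
      exact: measurable_poweR.
    exact: measurableT_comp.
  - by move=> y; exact: poweR_ge0.
rewrite nuT; case: ifPn => // _.
rewrite !ess_supEmu0; last 2 first.
- by apply: measurableT_comp => //; exact: measurableT_comp.
- exact: measurableT_comp.
congr ereal_inf; apply/seteqP; split => y /=; rewrite -hnu//;
  rewrite -[X in measurable X]setTI; apply: (measurableT_comp _ mf) => //;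
  exact: emeasurable_itv.
Qed.

End image_law.

(** * Moments and the support *)

(** A point outside of the support has a null neighbourhood, hence lies in a null
    interval with rational endpoints, and these intervals are countably many. *)
Lemma ae_msupport (R : realType) (m : probability R R) :
  \forall x \ae m, msupport m x.
Proof.
pose J (q : rat * rat) : set R := `](ratr q.1), (ratr q.2)[%classic.
pose F n : set R := if (unpickle n : option (rat * rat)) is Some q
  then if m (J q) == 0 then J q else set0 else set0.
apply: (@negligibleS _ _ _ _ (\bigcup_n F n)).
  move=> x /= /existsNP[U /not_implyP[oU /not_implyP[Ux /negP mU]]].
  have {}mU : m U = 0.
    by apply/eqP; move: mU; rewrite lt0e measure_ge0 andbT negbK.
  have /nbhs_ballP[e /= e0 xeU] : nbhs x U by exact: open_nbhs_nbhs.
  have /rat_in_itvoo[q1] : (x - e < x)%R by rewrite ltrBlDr ltrDl.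
  rewrite in_itv/= => /andP[xq1 q1x].
  have /rat_in_itvoo[q2] : (x < x + e)%R by rewrite ltrDl.
  rewrite in_itv/= => /andP[xq2 q2x].
  have IU : J (q1, q2) `<=` U.
    move=> y; rewrite /J/= in_itv/= => /andP[q1y yq2]; apply: xeU.
    rewrite -ball_normE /ball_/= ltr_norml; apply/andP; split; lra.
  exists (pickle (q1, q2)); first exact: I.
  rewrite /F pickleK.
  have -> : m (J (q1, q2)) = 0.
    by apply: (subset_measure0 _ _ IU mU) => //; exact: open_measurable.
  by rewrite eqxx /J /= in_itv/= q1x xq2.
apply: negligible_bigcup => n; rewrite /F.
case: unpickle => [q|]; last exact: negligible_set0.
case: ifPn => [/eqP mJ|_]; last exact: negligible_set0.
by apply/negligibleP => //; exact: measurable_itv.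
Qed.

(** For s = +oo: the support has full measure, so the essential supremum is at
    most the supremum over the support; conversely a point of the support beyond
    the essential supremum would have a null neighbourhood. *)
Lemma momentE (R : realType) (s : \bar R) (m : probability R R) : 1 <= s ->
  moment s m = 'N[m]_s[EFin].
Proof.
case: s => [s _|_|//]; first by [].
have mT : 0 < m setT by rewrite probability_setT.
have := Lnorm_ge0 m +oo EFin; rewrite [in X in X -> _]unlock [in RHS]unlock mT /=.
set M := ess_sup _ _ => M0.
apply/eqP; rewrite eq_le; apply/andP; split.
  apply: ge_ereal_sup => _ [x xm <-]; rewrite leNgt; apply/negP => Mx.
  have [r Mr] : exists r, M = r%:E.
    by case: M M0 Mx => [r|//|//] _ _; exists r.
  have oU : open [set y : R | (r < `|y|)%R].
    apply: (@open_comp _ _ (Num.norm : R -> R) [set y | (r < y)%R]).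
      by move=> y _; exact: norm_continuous.
    exact: open_gt.
  have /= := xm _ oU; rewrite Mr lte_fin in Mx => /(_ Mx).
  suff -> : m [set y : R | (r < `|y|)%R] = 0 by rewrite ltxx.
  apply: measure_negligible; first exact: open_measurable.
  apply: negligibleS (ess_sup_ge m (abse \o EFin)) => y /= ry.
  by apply/negP; rewrite -ltNge -/M Mr lte_fin.
apply/ess_supP; apply: filterS (ae_msupport m) => x xm /=.
by apply: ereal_sup_ubound; exists x.
Qed.

(** * The Hoelder inequality for conjugate exponents in [1, +oo] *)

Section extended_hoelder.
Context d (T : measurableType d) (R : realType) (P : probability T R).
Implicit Types f g : T -> R.

Lemma ae_le_Lnorm_infty f : \forall x \ae P, `|(f x)%:E| <= 'N[P]_+oo[EFin \o f].
Proof.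
have PT : 0 < P setT by rewrite probability_setT.
by rewrite unlock PT; exact: ess_sup_ge.
Qed.

Lemma hoelder_infty_1 f g :
  measurable_fun [set: T] f -> measurable_fun [set: T] g ->
  'N[P]_+oo[EFin \o f] < +oo ->
  'N[P]_1[EFin \o (f \* g)%R] <= 'N[P]_+oo[EFin \o f] * 'N[P]_1[EFin \o g].
Proof.
move=> mf mg; have := Lnorm_ge0 P +oo (EFin \o f).
have := ae_le_Lnorm_infty f.
case: ('N[P]_+oo[_]) => // M aeM M0 _; rewrite lee_fin in M0.
have mg' : measurable_fun [set: T] (fun x => `|(g x)%:E|).
  by apply: measurableT_comp => //; exact/measurable_EFinP.
rewrite !Lnorm1 -ge0_integralZl//.
apply: ae_ge0_le_integral => //.
- by apply: measurableT_comp => //; apply/measurable_EFinP; exact: measurable_funM.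
- by move=> x _; exact: mule_ge0.
- exact: measurable_funeM.
- by apply: filterS aeM => x fxM _ /=; rewrite normrM EFinM lee_wpmul2r.
Qed.

Lemma hoelder_extended (p : \bar R) f g : 1 <= p ->
  measurable_fun [set: T] f -> measurable_fun [set: T] g ->
  'N[P]_p[EFin \o f] < +oo -> 'N[P]_(hoelder_conjugate p)[EFin \o g] < +oo ->
  'N[P]_1[EFin \o (f \* g)%R] <=
  'N[P]_p[EFin \o f] * 'N[P]_(hoelder_conjugate p)[EFin \o g].
Proof.
case: p => [p|_|//]; last by rewrite hoelder_conjugatey => *; exact: hoelder_infty_1.
rewrite le_eqVlt => /predU1P[<-|p1] mf mg.
  rewrite hoelder_conjugate1 => _ goo; rewrite muleC.
  rewrite (_ : (f \* g)%R = (g \* f)%R); first exact: hoelder_infty_1.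
  by apply/funext => x /=; rewrite mulrC.
have p10 : (p - 1 != 0)%R by rewrite subr_eq0 gt_eqF.
have p0 : (0 < p)%R by rewrite (lt_trans ltr01).
have -> : hoelder_conjugate p%:E = (p / (p - 1))%:E.
  by rewrite /hoelder_conjugate/= eqe gt_eqF// -EFinB inver (negbTE p10).
move=> _ _; apply: hoelder => //.
  by rewrite divr_gt0// subr_gt0.
by field; rewrite p10 gt_eqF.
Qed.

End extended_hoelder.

(** * Gluing two probabilities along a discrete variable *)

Section gluing.
Context d1 d2 (T1 : measurableType d1) (T2 : measurableType d2) (R : realType).
Variables (P1 : probability T1 R) (P2 : probability T2 R).
Variables (phi : T1 -> nat) (psi : T2 -> nat).
Hypotheses (mphi : measurable_fun [set: T1] phi)
  (mpsi : measurable_fun [set: T2] psi).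
Hypothesis same : forall n, P1 (phi @^-1` [set n]) = P2 (psi @^-1` [set n]).

Let w (n : nat) : R := (fine (P1 (phi @^-1` [set n])))^-1.

(** Conditioning two independent points on falling into a common fiber: the
    inverse of the mass of that fiber makes both marginals right. On a null fiber
    the weight is 0^-1 = 0, which is harmless since the null fibers are countably
    many. *)
Definition glue_density (z : T1 * T2) : R :=
  (\1_[set z : T1 * T2 | phi z.1 = psi z.2] z * w (phi z.1))%R.

Lemma glue_density_ge0 z : (0 <= glue_density z)%R.
Proof. by rewrite mulr_ge0// invr_ge0 fine_ge0. Qed.

Lemma measurable_glue_event :
  measurable [set z : T1 * T2 | phi z.1 = psi z.2].
Proof.
rewrite (_ : [set _ | _] =
  \bigcup_n ((phi @^-1` [set n]) `*` (psi @^-1` [set n]))).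
  apply: bigcupT_measurable => n; apply: measurableX.
    by rewrite -[X in measurable X]setTI; exact: mphi.
  by rewrite -[X in measurable X]setTI; exact: mpsi.
apply/seteqP; split => [[a b] /= ab|[a b] [n _ [/= -> ->]]//].
by exists (phi a) => //; split.
Qed.

Lemma measurable_glue_density : measurable_fun [set: T1 * T2] glue_density.
Proof.
apply: measurable_funM; first exact: measurable_indic measurable_glue_event.
apply: (@measurableT_comp _ _ _ _ _ _ w) => //.
exact: measurableT_comp.
Qed.

Let measurable_EFin_glue_density :
  measurable_fun [set: T1 * T2] (fun z => (glue_density z)%:E).
Proof. by apply/measurable_EFinP; exact: measurable_glue_density. Qed.

Definition glue (A : set (T1 * T2)) : \bar R :=
  \int[P1 \x P2]_(z in A) (glue_density z)%:E.

Let glue0 : glue set0 = 0. Proof. by rewrite /glue integral_set0. Qed.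

Let glue_ge0 A : 0 <= glue A.
Proof. by apply: integral_ge0 => z _; rewrite lee_fin glue_density_ge0. Qed.

Let glue_sigma_additive : semi_sigma_additive glue.
Proof.
move=> F mF tF mUF; rewrite /glue; apply: cvg_toP.
  apply: ereal_nondecreasing_is_cvgn => m n mn.
  by apply: lee_sum_nneg_natr => // k _ _; exact: glue_ge0.
rewrite ge0_integral_bigcup//=.
- apply/measurable_funTS/measurable_EFinP; exact: measurable_glue_density.
- by move=> z _; rewrite lee_fin glue_density_ge0.
Qed.

HB.instance Definition _ := isMeasure.Build _ _ _ glue
  glue0 glue_ge0 glue_sigma_additive.

Lemma ae_fiber_neq0 d (T : measurableType d) (P : probability T R)
    (f : T -> nat) : measurable_fun [set: T] f ->
  \forall x \ae P, P (f @^-1` [set f x]) != 0.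
Proof.
move=> mf; apply: (@negligibleS _ _ _ _ (\bigcup_n
  (if P (f @^-1` [set n]) == 0 then f @^-1` [set n] else set0))).
  by move=> x /= /negP; rewrite negbK => fx0; exists (f x) => //=; rewrite fx0.
apply: negligible_bigcup => n; case: ifPn => [/eqP P0|_].
  by apply/negligibleP => //; rewrite -[X in measurable X]setTI; exact: mf.
exact: negligible_set0.
Qed.

(** The two partial integrals of the density are 1 almost everywhere; this is
    what gives the two marginals by Tonelli, and it is where the hypothesis that
    phi and psi have the same law enters. *)
Lemma integral_glue_density2 : \forall a \ae P1,
  \int[P2]_b (glue_density (a, b))%:E = 1.
Proof.
apply: filterS (ae_fiber_neq0 P1 mphi) => a Pa.
under eq_integral do rewrite EFinM.
have mfa : measurable (phi @^-1` [set phi a]).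
  by rewrite -[X in measurable X]setTI; exact: mphi.
have mpa : measurable (psi @^-1` [set phi a]).
  by rewrite -[X in measurable X]setTI; exact: mpsi.
rewrite (_ : (fun b => _) = (fun b => (\1_(psi @^-1` [set phi a]) b)%:E *
   (w (phi a))%:E)); last first.
  apply/funext => b; rewrite !indicE/=; congr (_%:R%:E * _).
  by congr nat_of_bool; apply/idP/idP; rewrite !inE.
rewrite ge0_integralZr//; last 2 first.
- by apply/measurable_EFinP.
- by rewrite lee_fin invr_ge0 fine_ge0.
rewrite integral_indic// setIT.
rewrite [X in X * _](_ : _ = (fine (P1 (phi @^-1` [set phi a])))%:E); last first.
  by rewrite fineK ?fin_num_measure// same.
by rewrite -EFinM mulfV// fine_eq0// fin_num_measure.
Qed.

Lemma integral_glue_density1 : \forall b \ae P2,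
  \int[P1]_a (glue_density (a, b))%:E = 1.
Proof.
apply: filterS (ae_fiber_neq0 P2 mpsi) => b Pb.
have mpb : measurable (phi @^-1` [set psi b]).
  by rewrite -[X in measurable X]setTI; exact: mphi.
rewrite (_ : (fun a => _) = (fun a => (\1_(phi @^-1` [set psi b]) a)%:E *
   (w (psi b))%:E)); last first.
  apply/funext => a; rewrite -EFinM; congr EFin; rewrite /glue_density !indicE/=.
  rewrite (_ : ((a, b) \in _) = (a \in phi @^-1` [set psi b])); last first.
    by apply/idP/idP; rewrite !inE.
  case: (boolP (a \in _)) => [|_]; last by rewrite !mul0r.
  by rewrite inE => /= ->.
rewrite ge0_integralZr//; last 2 first.
- by apply/measurable_EFinP.
- by rewrite lee_fin invr_ge0 fine_ge0.
rewrite integral_indic// setIT.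
rewrite [X in X * _](_ : _ = (fine (P1 (phi @^-1` [set psi b])))%:E); last first.
  by rewrite fineK// fin_num_measure.
rewrite /w same -EFinM mulfV// fine_eq0// fin_num_measure//.
by rewrite -[X in measurable X]setTI; exact: mpsi.
Qed.

Lemma glue_fst : has_law glue fst P1.
Proof.
move=> A mA; rewrite /glue integral_mkcond.
rewrite (_ : _ \_ _ = (fun z => (\1_A z.1)%:E * (glue_density z)%:E)); last first.
  apply/funext => z; rewrite patchE indicE /= (_ : (z \in fst @^-1` A) = (z.1 \in A)).
    by case: ifPn => _; rewrite /= ?mul1e ?mul0e.
  by apply/idP/idP; rewrite !inE.
rewrite fubini_tonelli1/=; last 2 first.
- apply: emeasurable_funM.
    by apply/measurable_EFinP; apply: (measurableT_comp (measurable_indic mA)).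
  exact: measurable_EFin_glue_density.
- by move=> z; rewrite mule_ge0// lee_fin ?glue_density_ge0.
rewrite /fubini_F/=.
under eq_integral.
  move=> a _; rewrite ge0_integralZl//; last 2 first.
  - apply/measurable_EFinP; apply: (measurableT_comp measurable_glue_density).
    exact: measurable_pair1.
  - by move=> b _; rewrite lee_fin glue_density_ge0.
  over.
rewrite (_ : P1 A = \int[P1]_a (\1_A a)%:E); last by rewrite integral_indic// setIT.
apply: ge0_ae_eq_integral => //.
- apply: emeasurable_funM; first by apply/measurable_EFinP.
  apply: (measurable_fun_fubini_tonelli_F (fun z => (glue_density z)%:E)) => //.
  by move=> z; rewrite lee_fin glue_density_ge0.
- exact/measurable_EFinP.
- move=> a _; rewrite mule_ge0 ?lee_fin//; apply: integral_ge0 => b _.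
  by rewrite lee_fin glue_density_ge0.
- by apply: filterS integral_glue_density2 => a -> _; rewrite mule1.
Qed.

Lemma glue_snd : has_law glue snd P2.
Proof.
move=> A mA; rewrite /glue integral_mkcond.
rewrite (_ : _ \_ _ = (fun z => (\1_A z.2)%:E * (glue_density z)%:E)); last first.
  apply/funext => z; rewrite patchE indicE /= (_ : (z \in snd @^-1` A) = (z.2 \in A)).
    by case: ifPn => _; rewrite /= ?mul1e ?mul0e.
  by apply/idP/idP; rewrite !inE.
rewrite fubini_tonelli2/=; last 2 first.
- apply: emeasurable_funM.
    by apply/measurable_EFinP; apply: (measurableT_comp (measurable_indic mA)).
  exact: measurable_EFin_glue_density.
- by move=> z; rewrite mule_ge0// lee_fin ?glue_density_ge0.
rewrite /fubini_G/=.
under eq_integral.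
  move=> b _; rewrite ge0_integralZl//; last 2 first.
  - apply/measurable_EFinP; apply: (measurableT_comp measurable_glue_density).
    exact: measurable_pair2.
  - by move=> a _; rewrite lee_fin glue_density_ge0.
  over.
rewrite (_ : P2 A = \int[P2]_b (\1_A b)%:E); last by rewrite integral_indic// setIT.
apply: ge0_ae_eq_integral => //.
- apply: emeasurable_funM; first by apply/measurable_EFinP.
  apply: (measurable_fun_fubini_tonelli_G (fun z => (glue_density z)%:E)) => //.
  by move=> z; rewrite lee_fin glue_density_ge0.
- exact/measurable_EFinP.
- move=> b _; rewrite mule_ge0 ?lee_fin//; apply: integral_ge0 => a _.
  by rewrite lee_fin glue_density_ge0.
- by apply: filterS integral_glue_density1 => b -> _; rewrite mule1.
Qed.

Let glue_setT : glue [set: T1 * T2] = 1.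
Proof. by rewrite -(preimage_setT fst) glue_fst// probability_setT. Qed.

HB.instance Definition _ := Measure_isProbability.Build _ _ R glue glue_setT.

Lemma ae_glue : \forall z \ae glue, phi z.1 = psi z.2.
Proof.
apply/negligibleP; first by apply: measurableC; exact: measurable_glue_event.
rewrite -[LHS]/(glue _) /glue (eq_integral (cst 0)) ?integral0// => z.
by rewrite inE => /= zne; rewrite /glue_density indicE memNset// mul0r.
Qed.

(** A substitute for the gluing of two laws along a common marginal: the variable
    being discrete, elementary conditioning replaces disintegration. *)
Lemma gluing : exists Q : probability (T1 * T2)%type R,
  [/\ has_law Q fst P1, has_law Q snd P2 & \forall z \ae Q, phi z.1 = psi z.2].
Proof. by exists glue; split; [exact: glue_fst|exact: glue_snd|exact: ae_glue]. Qed.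

End gluing.

(** * Cells of the real line *)

Section cells.
Context {R : realType}.

(** The index of the interval [k e, (k + 1) e[ that contains x, coded as a natural
    number. *)
Definition cell (e : R) (x : R) : nat := pickle (Num.floor (x / e)).

Lemma measurable_cell e : (0 < e)%R -> measurable_fun [set: R] (cell e).
Proof.
move=> e0 _ A _; rewrite setTI.
rewrite (_ : _ @^-1` _ = \bigcup_(n in A) (cell e @^-1` [set n])); last first.
  apply/seteqP; split => [x Ax|x [n An xn]]; first by exists (cell e x).
  by rewrite /preimage/= (xn : cell e x = n).
apply: bigcup_measurable => n _.
have [[k kn]|nk] := pselect (exists k : int, pickle k = n); last first.
  rewrite (_ : _ @^-1` _ = set0)// -subset0 => x /= xn.
  by apply: nk; exists (Num.floor (x / e)).
rewrite (_ : _ @^-1` _ = `[k%:~R * e, (k + 1)%:~R * e[%classic)%R; last first.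
  apply/seteqP; split => x /=; rewrite in_itv/= -ler_pdivlMr// -ltr_pdivrMr//.
    move=> xn; rewrite (_ : k = Num.floor (x / e)); first exact: floor_itv.
    by apply: (pcan_inj (@pickleK int)); rewrite kn.
  by rewrite -floor_eq => /eqP xk; rewrite /cell xk.
exact: measurable_itv.
Qed.

Lemma cell_eq e x y : (0 < e)%R -> cell e x = cell e y -> (`|x - y| < e)%R.
Proof.
move=> e0 /(pcan_inj (@pickleK int)) xy.
have := floor_itv (x / e); have := floor_itv (y / e); rewrite xy intrD.
set f := (_%:~R)%R; rewrite !ler_pdivlMr// !ltr_pdivrMr// mulrDl mul1r.
by move=> /andP[? ?] /andP[? ?]; rewrite ltr_norml; apply/andP; split; lra.
Qed.

End cells.

(** * Pairing a risk with a density *)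

Section ae_le_Rintegral.
Context d (T : measurableType d) (R : realType) (mu : {measure set T -> \bar R}).

Lemma ae_le_Rintegral (f g : T -> R) :
  mu.-integrable [set: T] (EFin \o f) -> mu.-integrable [set: T] (EFin \o g) ->
  (\forall x \ae mu, (f x <= g x)%R) ->
  (\int[mu]_x f x <= \int[mu]_x g x)%R.
Proof.
move=> intf intg fg; rewrite -subr_ge0 -RintegralB// /Rintegral.
have mgf : measurable_fun [set: T] (fun x => (g x - f x)%R).
  by apply: measurable_funB; apply/measurable_EFinP; exact: measurable_int intg
    || exact: measurable_int intf.
rewrite (ae_eq_integral (fun x => `|g x - f x|%:E)) //.
- by rewrite fine_ge0// integral_ge0.
- exact/measurable_EFinP.
- by apply/measurable_EFinP; exact: measurableT_comp.
- by apply: filterS fg => x fgx _; rewrite ger0_norm// subr_ge0.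
Qed.

End ae_le_Rintegral.

Section pairing.
Context d (U : measurableType d) (R : realType) (Q : probability U R).
Variables (p : \bar R) (p1 : 1 <= p) (f y : U -> R) (m r : probability R R).
Hypotheses (mf : measurable_fun [set: U] f) (my : measurable_fun [set: U] y).
Hypotheses (fm : has_law Q f m) (yr : has_law Q y r).
Hypotheses (m_fin : moment p m < +oo)
  (r_fin : moment (hoelder_conjugate p) r < +oo).

Lemma moment_law (s : \bar R) (g : U -> R) (n : probability R R) : 1 <= s ->
  measurable_fun [set: U] g -> has_law Q g n -> moment s n = 'N[Q]_s[EFin \o g].
Proof.
move=> s1 mg gn; rewrite momentE//; apply: Lnorm_law => //.
by rewrite (le_trans _ s1).
Qed.

Lemma pairing_norm_le :
  \int[Q]_u `|(f u * y u)%:E| <= moment p m * moment (hoelder_conjugate p) r.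
Proof.
have q1 := hoelder_conj_ge1 p1.
move: m_fin r_fin; rewrite (moment_law p1 mf fm) (moment_law q1 my yr) => Nf Ny.
by have := hoelder_extended p1 mf my Nf Ny; rewrite Lnorm1.
Qed.

Lemma pairing_integrable : Q.-integrable [set: U] (fun u => (f u * y u)%:E).
Proof.
apply/integrableP; split; first exact/measurable_EFinP/measurable_funM.
apply: le_lt_trans pairing_norm_le _.
have q1 := hoelder_conj_ge1 p1.
apply: lte_mul_pinfty => //; first by rewrite momentE// Lnorm_ge0.
by rewrite ge0_fin_numE// momentE// Lnorm_ge0.
Qed.

End pairing.

Section cost.
Context d (T : measurableType d) (R : realType) (P : probability T R).
Variables (p : \bar R) (p1 : 1 <= p) (S : set (probability R R)).
Local Notation q := (hoelder_conjugate p).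
Local Notation Lp := (LfunType P p1).
Hypothesis S_neq0 : S !=set0.
Hypothesis S_bounded : ereal_sup [set moment q r | r in S] < +oo.
Hypothesis S_density : forall r, S r ->
  msupport r `<=` [set y | (0 <= y)%R] /\ \int[r]_y y%:E = 1.

Lemma measurable_Lfun (X : Lp) : measurable_fun [set: T] X.
Proof. exact: measurable_funPT. Qed.

Lemma law_has_law (X : Lp) : has_law P X (law X).
Proof. by []. Qed.

Lemma law_finite_moment (X : Lp) : moment p (law X) < +oo.
Proof.
rewrite (moment_law p1 (measurable_Lfun X) (law_has_law X)).
exact: Lfunction_finite.
Qed.

Lemma S_moment r : S r -> moment q r < +oo.
Proof.
by move=> Sr; apply: le_lt_trans S_bounded; apply: ereal_sup_ubound; exists r.
Qed.

(** The law of (f, y) is one of the couplings over which chi is the supremum. *)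
Lemma pairing_le_chi d' (U : measurableType d') (Q : probability U R)
    (f y : U -> R) (X : Lp) r :
  measurable_fun [set: U] f -> measurable_fun [set: U] y ->
  has_law Q f (law X) -> S r -> has_law Q y r ->
  \int[Q]_u (f u * y u)%:E <= chi S (law X).
Proof.
move=> mf my fX Sr yr.
have mfy : measurable_fun [set: U] (fun u => (f u, y u)).
  exact: measurable_fun_pair.
pose fy : {mfun U >-> (R * R)%type} := HB.pack (fun u => (f u, y u))
  (isMeasurableFun.Build _ _ _ _ _ mfy).
apply: ereal_sup_ubound; exists (distribution Q fy).
  by split; [exact: fX|exists r; [|exact: yr]].
rewrite (@integral_law _ _ _ _ _ Q _ fy)//.
  by apply/measurable_EFinP; exact: measurable_funM.
exact: (pairing_integrable p1 mf my fX yr (law_finite_moment X) (S_moment Sr)).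
Qed.

(** Bounded below by the mean under the independent coupling with some element of
    S, above by the Hoelder inequality and the uniform bound on S. *)
Lemma chi_fin_num (X : Lp) : chi S (law X) \is a fin_num.
Proof.
rewrite fin_numElt; apply/andP; split.
  have [r Sr] := S_neq0.
  have XrX : has_law (law X \x r) fst (law X).
    move=> A mA; rewrite -[_ @^-1` _]setXT product_measure1E//.
    by rewrite [X in _ * X](_ : _ = 1) ?mule1//; exact: probability_setT.
  have Xrr : has_law (law X \x r) snd r.
    move=> A mA; rewrite -[_ @^-1` _]setTX product_measure1E//.
    by rewrite [X in X * _](_ : _ = 1) ?mul1e//; exact: probability_setT.
  apply: lt_le_trans (@pairing_le_chi _ _ (law X \x r) fst snd X r
    measurable_fst measurable_snd XrX Sr Xrr).
  have := pairing_integrable p1 measurable_fst measurable_snd XrX Xrr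
    (law_finite_moment X) (S_moment Sr).
  by move/integrable_fin_num => /(_ measurableT); rewrite fin_numElt => /andP[].
have M0 : 0 <= moment p (law X) by rewrite momentE// Lnorm_ge0.
set C := ereal_sup [set moment q r | r in S].
have C0 : 0 <= C.
  have [r Sr] := S_neq0; apply: (@le_trans _ _ (moment q r)).
    by rewrite momentE ?Lnorm_ge0// hoelder_conj_ge1.
  by apply: ereal_sup_ubound; exists r.
apply: (@le_lt_trans _ _ (moment p (law X) * C)); last first.
  by apply: lte_mul_pinfty => //; rewrite ge0_fin_numE// law_finite_moment.
apply: ge_ereal_sup => _ [pi [piX [r Sr pir]] <-].
apply: le_trans (lee_abs _) _.
apply: le_trans (le_abse_integral _ _ _) _ => //.
  by apply/measurable_EFinP; exact: measurable_funM.
apply: le_trans (pairing_norm_le p1 measurable_fst measurable_snd piX pir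
  (law_finite_moment X) (S_moment Sr)) _.
by apply: lee_wpmul2l => //; apply: ereal_sup_ubound; exists r.
Qed.

(** The last two coordinates are the point (x, y) of the coupling that Q lifts
    to T. *)
Definition scenario (Q : probability (T * (R * R))%type R) :=
  has_law Q fst P /\ exists2 r, S r & has_law Q (snd \o snd) r.

Definition scenario_mean (Q : probability (T * (R * R))%type R) (X : T -> R) : R :=
  (\int[Q]_z (X z.1 * z.2.2))%R.

Section scenario_theory.
Variable Q : probability (T * (R * R))%type R.
Hypothesis sQ : scenario Q.

Let mweight : measurable_fun [set: T * (R * R)] (snd \o snd : _ -> R).
Proof. exact: measurableT_comp. Qed.

Let mpull (X : Lp) : measurable_fun [set: T * (R * R)] (X \o fst).
Proof. exact: measurableT_comp (measurable_Lfun X) measurable_fst. Qed.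

Let pull_law (X : Lp) : has_law Q (X \o fst) (law X).
Proof.
move=> A mA; have [QP _] := sQ; rewrite comp_preimage QP//.
by rewrite -[X in measurable X]setTI; exact: measurable_Lfun.
Qed.

Lemma scenario_integrable (X : Lp) :
  Q.-integrable [set: T * (R * R)] (EFin \o (fun z => X z.1 * z.2.2)%R).
Proof.
have [_ [r Sr Qr]] := sQ.
exact: (pairing_integrable p1 (mpull X) mweight (pull_law X) Qr
  (law_finite_moment X) (S_moment Sr)).
Qed.

Lemma scenario_le_rho (X : Lp) : (scenario_mean Q X <= rho_of S X)%R.
Proof.
have [_ [r Sr Qr]] := sQ.
apply: fine_le; [|exact: chi_fin_num|].
  exact: integrable_fin_num (scenario_integrable X).
exact: (pairing_le_chi (mpull X) mweight (pull_law X) Sr Qr).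
Qed.

Lemma scenario_weight_ge0 : \forall z \ae Q, (0 <= z.2.2)%R.
Proof.
have [_ [r Sr Qr]] := sQ.
apply: (@ae_law _ _ _ _ _ Q r _ mweight Qr (fun y => 0 <= y)%R).
by apply: filterS (ae_msupport r); have [+ _] := S_density Sr; exact.
Qed.

Lemma scenario_mean_cst (c : R) : scenario_mean Q (Lcst P p1 c) = c.
Proof.
have [_ [r Sr Qr]] := sQ.
have int1 := scenario_integrable (Lcst P p1 1).
have -> : scenario_mean Q (Lcst P p1 c) =
    (c * \int[Q]_z ((Lcst P p1 1) z.1 * z.2.2))%R.
  rewrite -RintegralZl//; apply: eq_Rintegral => z _ /=.
  by rewrite mul1r.
rewrite /Rintegral; under eq_integral do rewrite /= mul1r.
rewrite -(@integral_law _ _ _ _ _ Q r _ mweight Qr EFin)//.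
- by have [_ ->] := S_density Sr; rewrite mulr1.
- apply: eq_integrable int1 => // z _ /=; by rewrite mul1r.
Qed.

Lemma scenario_meanD (X Y : Lp) :
  (scenario_mean Q (X + Y)%R = scenario_mean Q X + scenario_mean Q Y)%R.
Proof.
rewrite -RintegralD//; [|exact: scenario_integrable..].
by apply: eq_Rintegral => z _ /=; rewrite -mulrDl.
Qed.

Lemma scenario_meanZ (c : R) (X : Lp) :
  (scenario_mean Q (c *: X) = c * scenario_mean Q X)%R.
Proof.
rewrite -RintegralZl//; last exact: scenario_integrable.
by apply: eq_Rintegral => z _ /=; rewrite mulrA.
Qed.

Lemma le_scenario_mean (X Y : Lp) : (\forall w \ae P, (X w <= Y w)%R) ->
  (scenario_mean Q X <= scenario_mean Q Y)%R.
Proof.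
move=> XY; apply: ae_le_Rintegral; [exact: scenario_integrable..|].
have [QP _] := sQ.
have := ae_law measurable_fst QP XY.
apply: filterS2 scenario_weight_ge0 => z z0 XYz.
exact: ler_wpM2r.
Qed.

End scenario_theory.

(** Glue P and a nearly optimal coupling pi along the cells of X and of the first
    coordinate of pi. One half of e pays for the near optimality, the other half
    for the width of the cells. *)
Lemma rho_le_scenario (X : Lp) (e : R) : (0 < e)%R ->
  exists2 Q, scenario Q & (rho_of S X <= scenario_mean Q X + e)%R.
Proof.
move=> e0; have h0 : (0 < e / 2)%R by rewrite divr_gt0.
have [_ [pi [piX [r Sr pir]] <-]] :=
  ub_ereal_sup_adherent h0 (chi_fin_num X).
set chiX := ereal_sup _ => chi_pi.
have mcX : measurable_fun [set: T] (cell (e / 2) \o X).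
  exact: measurableT_comp (measurable_cell h0) (measurable_Lfun X).
have mc1 : measurable_fun [set: R * R] (cell (e / 2) \o fst : R * R -> nat).
  exact: measurableT_comp (measurable_cell h0) measurable_fst.
have same n : P ((cell (e / 2) \o X) @^-1` [set n]) =
    pi ((cell (e / 2) \o fst) @^-1` [set n]).
  have mcn : measurable (cell (e / 2) @^-1` [set n]).
    by rewrite -[X in measurable X]setTI; exact: measurable_cell.
  exact: (esym (piX _ mcn)).
have [Q [QP Qpi Qcell]] := gluing mcX mc1 same.
have Qr : has_law Q (snd \o snd) r.
  move=> A mA; rewrite comp_preimage Qpi ?pir//.
  by rewrite -[X in measurable X]setTI; exact: measurable_snd.
have sQ : scenario Q by split=> //; exists r.
exists Q => //.
have Q1 : has_law Q (fst \o snd) (law X).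
  move=> A mA; rewrite comp_preimage Qpi ?piX//.
  by rewrite -[X in measurable X]setTI; exact: measurable_fst.
have m21 : measurable_fun [set: T * (R * R)] (fst \o snd : _ -> R).
  exact: measurableT_comp.
have m22 : measurable_fun [set: T * (R * R)] (snd \o snd : _ -> R).
  exact: measurableT_comp.
have int12 := pairing_integrable p1 m21 m22 Q1 Qr
  (law_finite_moment X) (S_moment Sr).
have intX := scenario_integrable sQ X.
have inte := scenario_integrable sQ (Lcst P p1 (e / 2)).
have pi_le : (fine (\int[pi]_z (z.1 * z.2)%:E) <= scenario_mean Q X + e / 2)%R.
  rewrite (integral_law measurable_snd Qpi)//; last first.
    by apply/measurable_EFinP; exact: measurable_funM.
  rewrite -[X in (_ <= _ + X)%R](scenario_mean_cst sQ).
  rewrite -RintegralD//.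
  apply: ae_le_Rintegral => //; first exact: (integrableD measurableT intX inte).
  apply: filterS2 (scenario_weight_ge0 sQ) Qcell => z z0 zc.
  rewrite /= -mulrDl ler_wpM2r//.
  by have := cell_eq h0 zc; rewrite ltr_norml => /andP[? ?]; lra.
have pi_fin : \int[pi]_z (z.1 * z.2)%:E \is a fin_num.
  rewrite (integral_law measurable_snd Qpi)//.
    exact: integrable_fin_num int12.
  by apply/measurable_EFinP; exact: measurable_funM.
have : (fine (chi S (law X)) - e / 2 <= fine (\int[pi]_z (z.1 * z.2)%:E))%R.
  rewrite -lee_fin EFinB !fineK//; last exact: chi_fin_num.
  exact: ltW.
rewrite /rho_of; lra.
Qed.

(** Each axiom holds for all the scenario means, which bound rho from below and
    approach it. *)
Lemma rho_coherent : coherent (@rho_of d T R P p p1 S).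
Proof.
have approx (X : Lp) (y : R) :
    (forall Q, scenario Q -> scenario_mean Q X <= y)%R -> (rho_of S X <= y)%R.
  move=> Xy; apply/ler_addgt0Pr => e e0.
  have [Q sQ /le_trans] := rho_le_scenario X e0; apply.
  by rewrite lerD2r Xy.
have le_rho (X : Lp) Q (sQ : scenario Q) := scenario_le_rho sQ X.
split=> [X a|X c c0|X1 X2 X12|X1 X2 t /andP[t0 t1]].
- apply/eqP; rewrite eq_le; apply/andP; split.
    apply: approx => Q sQ; rewrite scenario_meanD// scenario_mean_cst//.
    by rewrite lerD2r le_rho.
  rewrite -lerBrDr; apply: approx => Q sQ.
  have := le_rho (X + Lcst P p1 a)%R Q sQ.
  by rewrite scenario_meanD// scenario_mean_cst// lerBrDr.
- apply/eqP; rewrite eq_le; apply/andP; split.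
    by apply: approx => Q sQ; rewrite scenario_meanZ// ler_wpM2l// le_rho.
  (* no division by c here, but any scenario bounds rho from below by 0 *)
  have [c_eq0|cn0] := eqVneq c 0%R.
    have [Q sQ _] := rho_le_scenario X ltr01.
    by have := le_rho (c *: X)%R Q sQ; rewrite scenario_meanZ// c_eq0 !mul0r.
  have cp : (0 < c)%R by rewrite lt_neqAle eq_sym cn0.
  rewrite mulrC -ler_pdivlMr//; apply: approx => Q sQ.
  by rewrite ler_pdivlMr// mulrC -scenario_meanZ// le_rho.
- apply: approx => Q sQ; apply: le_trans (le_rho X2 Q sQ).
  exact: le_scenario_mean.
- apply: approx => Q sQ; rewrite scenario_meanD// !scenario_meanZ//.
  by apply: lerD; rewrite ler_wpM2l ?le_rho// subr_ge0.
Qed.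

Lemma rho_law_invariant : law_invariant (@rho_of d T R P p p1 S).
Proof.
move=> X1 X2 X12; rewrite /rho_of /chi (_ : couplings _ S = couplings (law X2) S)//.
apply/seteqP; split => pi [pi1 pi2]; split => // A mA; rewrite pi1//.
  exact: X12.
by rewrite X12.
Qed.

End cost.

Theorem theorem3p1 (R : realType) (p : \bar R) (p1 : 1 <= p)
    (d : measure_display) (T : measurableType d) (P : probability T R)
    (S : set (probability R R)) :
  S `<=` finite_moment (hoelder_conjugate p) ->
  S !=set0 ->
  ereal_sup [set moment (hoelder_conjugate p) r | r in S] < +oo ->
  (forall r, S r ->
    msupport r `<=` [set y | (0 <= y)%R] /\ \int[r]_y y%:E = 1) ->
  (forall X : LfunType P p1,
    finite_moment p (law X) /\ chi S (law X) \is a fin_num) /\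
  [/\ risk_measure (@rho_of d T R P p p1 S),
      coherent (@rho_of d T R P p p1 S)
    & law_invariant (@rho_of d T R P p p1 S)].
Proof.
move=> _ S0 Sb S1; split=> [X|].
  by split; [exact: law_finite_moment|exact: chi_fin_num].
have coh : coherent (@rho_of d T R P p p1 S) by exact: rho_coherent.
split=> //; last exact: rho_law_invariant.
(* almost sure equality is almost sure inequality both ways *)
move=> X1 X2 X12; have [_ _ mono _] := coh.
apply/eqP; rewrite eq_le !mono//.
- by apply: filterS X12 => w ->.
- by apply: filterS X12 => w ->.
Qed.
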